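(* Let $K$ be a field and let $G$ be a finite simple graph without isolated vertices with $|E_G|>1$. Fix a grevlex order on $K[E_G]$ and let $\mathscr{G}=\mathscr{T}\cup\mathscr{E}$ be the Gröbner basis of the Eulerian ideal $I(X_G)$ consisting of $\mathscr{T}=\{t_h^2-t_\ell^2 : h,\ell\in E_G\}$ and the set $\mathscr{E}$ of Eulerian binomials. Let $\mathbf{t}^\delta,\mathbf{t}^\gamma$ be monomials in $K[E_G]$. (i) If the monomial $\mathbf{t}^\delta$ is the remainder of the division of $\mathbf{t}^\gamma$ by an element of $\mathscr{G}$, then $\theta(\mathbf{t}^\delta)=\theta(\mathbf{t}^\gamma)$ and $|\mathcal{J}(\mathbf{t}^\delta)|\equiv|\mathcal{J}(\mathbf{t}^\gamma)| \pmod 2$. (ii) The remainder in a standard expression of $\mathbf{t}^\gamma$ with respect to $\mathscr{G}$ is a monomial $\mathbf{t}^\delta$ with $$|\mathcal{J}(\mathbf{t}^\delta)|=\min\{|J| : J \text{ is a } \theta(\mathbf{t}^\gamma)\text{-join and } |J|\equiv|\mathcal{J}(\mathbf{t}^\gamma)| \pmod 2\}.$$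
   Context: $G$ has vertex set $V_G$ and edge set $E_G$, a non-empty set of $2$-element subsets of $V_G$. Put $K[V_G]=K[x_i : i\in V_G]$ and $K[E_G]=K[t_h : h\in E_G]$. Let $\varphi\colon K[E_G]\to K[V_G]$ be the $K$-algebra homomorphism with $\varphi(t_h)=x_ix_j$ for $h=\{i,j\}\in E_G$. The Eulerian ideal of $G$ is $I(X_G)=\varphi^{-1}\big((x_i^2-x_j^2 : i,j\in V_G)\big)\subset K[E_G]$. For $\alpha\colon E_G\to\mathbb{N}$, write $\mathbf{t}^\alpha=\prod_{h\in E_G}t_h^{\alpha(h)}$ and $\mathcal{J}(\mathbf{t}^\alpha)=\{h\in E_G : \alpha(h)\text{ is odd}\}$. Let $\theta(\mathbf{t}^\alpha)\subset V_G$ be the set of odd degree vertices of the subgraph of $G$ edge-induced by $\mathcal{J}(\mathbf{t}^\alpha)$. For $T\subset V_G$ (possibly empty), a $T$-join is a subset $J\subset E_G$ such that $T$ is precisely the set of odd degree vertices of the subgraph edge-induced by $J$. A subgraph of $G$ is called even Eulerian if all its vertices have even degree in the subgraph and its edge set has even cardinality (it need be neither connected nor spanning). A binomial $\mathbf{t}^\alpha-\mathbf{t}^\beta$ is called Eulerian if $\mathbf{t}^\alpha$ and $\mathbf{t}^\beta$ are distinct, relatively prime, square-free monomials of the same degree and the subgraph edge-induced by $\mathcal{J}(\mathbf{t}^\alpha)\cup\mathcal{J}(\mathbf{t}^\beta)$ is an even Eulerian subgraph of $G$. A grevlex order on $K[E_G]$ is the graded reverse lexicographic order induced by $t_{\epsilon(1)}\succ\cdots\succ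 t_{\epsilon(s)}$, where $s=|E_G|$ and $\epsilon\colon\{1,\dots,s\}\to E_G$ is a bijection. It is known that $\mathscr{G}$ is a Gröbner basis of $I(X_G)$ for any such order (the zero polynomial obtained in $\mathscr{T}$ when $h=\ell$ is disregarded). A division of a monomial $\mathbf{t}^\gamma$ by $g\in\mathscr{G}$ with leading term dividing $\mathbf{t}^\gamma$ replaces that leading monomial factor by the other monomial of $g$. A standard expression of $f$ with respect to $\mathscr{G}$ is an expression $f=\sum_{g\in\mathscr{G}}q_g g+r$ as produced by the division algorithm: no monomial of the remainder $r$ is divisible by a leading monomial of an element of $\mathscr{G}$, and the leading monomial of each nonzero $q_g g$ is at most that of $f$. *)

(* Defs.v *)
From HB Require Import structures.
From mathcomp Require Import all_boot all_order all_algebra.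
From mathcomp Require Import mpoly.

Set Implicit Arguments.
Unset Strict Implicit.
Unset Printing Implicit Defensive.

Import GRing.Theory.
Local Open Scope ring_scope.

Record sgraph := SGraph {
  vertex : finType;
  edges : {set {set vertex}};
  edges_card2 : forall h, h \in edges -> #|h| = 2%N
}.

Notation edge G := {h : {set vertex G} | h \in edges G}.

Definition no_isolated_vertex (G : sgraph) : Prop :=
  forall v : vertex G, exists h : edge G, v \in val h.

Section Graph.
Variable G : sgraph.
Implicit Types (J : {set edge G}) (T : {set vertex G}).

(* Vertex set of the subgraph edge-induced by J, and degrees in it. *)
Definition induced_vertices J : {set vertex G} := \bigcup_(h in J) val h.
Definition degree J (v : vertex G) : nat := #|[set h in J | v \in val h]|.

Definition odd_vertices J : {set vertex G} :=
  [set v in induced_vertices J | odd (degree J v)].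

Definition is_join T J : Prop := odd_vertices J = T.

Definition even_eulerian J : Prop :=
  {in induced_vertices J, forall v, ~~ odd (degree J v)} /\ ~~ odd #|J|.

End Graph.

(* The ring K[E_G].  The variable t_h is the one of index [enum_rank h]; this
   is only a fixed naming of the variables, the monomial order being given by
   a separate enumeration of the edges. *)

Notation mon G := 'X_{1..#|{: edge G}|}.
Notation epoly K G := {mpoly K[#|{: edge G}|]}.

Section Monomials.
Variable G : sgraph.
Implicit Types a b m : mon G.

Definition expo a (h : edge G) : nat := a (enum_rank h).

Definition Jset a : {set edge G} := [set h | odd (expo a h)].
Definition theta a : {set vertex G} := odd_vertices (Jset a).

Definition squarefree a : Prop := forall h, (expo a h <= 1)%N.
Definition rel_prime a b : Prop := forall h, expo a h = 0%N \/ expo b h = 0%N.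

(* Graded reverse lexicographic order with t_(e 0) > t_(e 1) > ... : in equal
   degree, a < b when the last exponent at which they differ is larger in a. *)
Definition grevlex_lt (e : 'I_#|{: edge G}| -> edge G) a b : bool :=
  (mdeg a < mdeg b)%N ||
  (mdeg a == mdeg b) &&
    [exists i : 'I_#|{: edge G}|, (expo b (e i) < expo a (e i))%N &&
      [forall j : 'I_#|{: edge G}|, (i < j)%N ==> (expo a (e j) == expo b (e j))]].

Definition grevlex_le e a b : bool := (a == b) || grevlex_lt e a b.

End Monomials.

Section Division.
Variables (K : fieldType) (G : sgraph).
Implicit Types (f g p r : epoly K G) (a b m : mon G).

Definition tvar (h : edge G) : epoly K G := 'X_(enum_rank h).

Definition Tset p : Prop :=
  exists h l : edge G, h != l /\ p = tvar h ^+ 2 - tvar l ^+ 2.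

Definition eulerian_binomial p : Prop :=
  exists a b : mon G,
    [/\ p = 'X_[a] - 'X_[b],
        [/\ a <> b, rel_prime a b, squarefree a & squarefree b],
        mdeg a = mdeg b
      & even_eulerian (Jset a :|: Jset b)].

Definition Gset p : Prop := Tset p \/ eulerian_binomial p.

Variable e : 'I_#|{: edge G}| -> edge G.

(* m is the leading monomial of p; the zero polynomial has none. *)
Definition is_lead p m : Prop :=
  m \in msupp p /\ {in msupp p, forall m', grevlex_le e m' m}.

(* g is meant to be one of the binomials t^m - t^m' or t^m' - t^m of Gset,
   whose support is {m, m'}. *)
Definition division_remainder g (c d : mon G) : Prop :=
  exists m m' : mon G,
    [/\ is_lead g m, m' \in msupp g, m' <> m, (m <= c)%MM
      & d = (c - m + m')%MM].

(* [gs] lists the elements of B with a possibly nonzero coefficient, so that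
   the sum over B is the finite sum over [gs]. *)
Definition standard_expression (B : epoly K G -> Prop) f
    (gs : seq (epoly K G)) (q : epoly K G -> epoly K G) r : Prop :=
  [/\ uniq gs /\ {in gs, forall g, B g},
      f = \sum_(g <- gs) q g * g + r,
      forall m g l, m \in msupp r -> B g -> is_lead g l -> ~~ (l <= m)%MM
    & {in gs, forall g m, is_lead (q g * g) m ->
        exists2 l, is_lead f l & grevlex_le e m l}].

End Division.

Definition is_min (P : nat -> Prop) (k : nat) : Prop :=
  P k /\ forall k', P k' -> (k <= k')%N.

(* Main.v *)
(* Call two monomials equivalent when they have the same degree and the same
   theta.  Every element of G is a difference of equivalent monomials, and
   equivalence is stable under multiplication, so the sum of the coefficients of
   a polynomial over a class vanishes on the ideal generated by G.  Each class
   contains at most one monomial divisible by no leading monomial of G.  Hence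
   the remainder of t^c, whose class sums are those of t^c, is a single such
   monomial; an exchange argument shows that its odd part is a minimum join. *)
Require Import Defs.
From mathcomp Require Import all_boot all_order all_algebra.
From mathcomp Require Import mpoly.
From mathcomp Require Import zify.

Set Implicit Arguments.
Unset Strict Implicit.
Unset Printing Implicit Defensive.

Import GRing.Theory.
Local Open Scope ring_scope.

Lemma odd_eq_gap (m n : nat) :
  odd m = odd n -> (n < m)%N -> exists k, m = (n + k.+1 * 2)%N.
Proof.
move=> eq_odd ltnm; exists (m - n)./2.-1.
have ev : ~~ odd (m - n) by rewrite oddB 1?ltnW // eq_odd addbb.
have := even_halfK ev; rewrite -muln2; move: (_./2) => k; lia.
Qed.

Lemma exists_subset_card (T : finType) (A : {set T}) (k : nat) :
  (k <= #|A|)%N -> exists2 B : {set T}, B \subset A & #|B| = k.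
Proof.
move=> lekA; have: (0 < #|[set B : {set T} | (B \subset A) && (#|B| == k)]|)%N.
  by rewrite cards_draws bin_gt0.
by case/card_gt0P=> B; rewrite inE => /andP[sBA /eqP cB]; exists B.
Qed.

(** * Degrees modulo 2, joins and classes of monomials *)

Section Parity.
Variable G : sgraph.
Implicit Types (J A B : {set edge G}) (a b m : mon G).

Lemma odd_verticesE J : odd_vertices J = [set v | odd (degree J v)].
Proof.
apply/setP=> v; rewrite !inE andbC; case: (boolP (odd _)) => //= odd_v.
have: (0 < degree J v)%N by case: (degree J v) odd_v.
case/card_gt0P=> h; rewrite inE => /andP[hJ vh].
by apply/bigcupP; exists h.
Qed.

Lemma degreeE J v : degree J v = #|J :&: [set h : edge G | v \in val h]|.
Proof. by apply: eq_card => h; rewrite !inE. Qed.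

Lemma degree_split J A v : degree J v = (degree (J :&: A) v + degree (J :\: A) v)%N.
Proof. by rewrite !degreeE setIAC setIDAC cardsID. Qed.

(** Modulo 2, degrees and cardinalities add under symmetric difference, because the edges of
    [A :&: B] are counted twice and cancel. *)
Lemma even_eulerian_symdiff A B :
    odd_vertices A = odd_vertices B -> odd #|A| = odd #|B| ->
  even_eulerian ((A :\: B) :|: (B :\: A)).
Proof.
set F := _ :|: _ => thAB cAB.
have FB : F :&: B = B :\: A.
  by apply/setP=> h; rewrite !inE; case: (h \in A); case: (h \in B).
have FNB : F :\: B = A :\: B.
  by apply/setP=> h; rewrite !inE; case: (h \in A); case: (h \in B).
split=> [v _|].
  move/setP/(_ v): thAB; rewrite !odd_verticesE !inE.
  rewrite (degree_split F B) FB FNB (degree_split A B) (degree_split B A).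
  by rewrite (setIC B A) !oddD; do 3!case: (odd _).
move: cAB; rewrite -(cardsID B F) FB FNB -(cardsID B A) -(cardsID A B).
by rewrite (setIC B A) !oddD; do 3!case: (odd _).
Qed.

(** This is the exponent of x_v in φ(t^a); its parity decides whether v lies in [theta a]. *)
Definition vdeg a v : nat := (\sum_(h : edge G | v \in val h) expo a h)%N.

Lemma vdegD a b v : vdeg (a + b)%MM v = (vdeg a v + vdeg b v)%N.
Proof. by rewrite -big_split; apply: eq_bigr => h _; rewrite /expo mnmDE. Qed.

Lemma mdeg_expo a : mdeg a = (\sum_(h : edge G) expo a h)%N.
Proof.
by rewrite mdegE (reindex _ (onW_bij _ (enum_rank_bij {: edge G}))).
Qed.

Lemma odd_sum (I : finType) (P : pred I) (F : I -> nat) :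
  odd (\sum_(i | P i) F i) = odd #|[set i | P i & odd (F i)]|.
Proof.
rewrite -sum1dep_card [in RHS]big_mkcondr /=.
rewrite !(big_morph odd oddD (erefl _)).
by apply: eq_bigr => i _; case: ifP.
Qed.

Lemma odd_degree a v : odd (degree (Jset a) v) = odd (vdeg a v).
Proof.
rewrite /vdeg odd_sum /degree; congr odd.
by apply: eq_card => h; rewrite !inE andbC.
Qed.

Lemma odd_card_Jset a : odd #|Jset a| = odd (mdeg a).
Proof.
by rewrite mdeg_expo odd_sum.
Qed.

Lemma thetaE a : theta a = [set v | odd (vdeg a v)].
Proof.
by rewrite /theta odd_verticesE; apply/setP=> v; rewrite !inE odd_degree.
Qed.

(** The full degree is recorded, not only its parity: this keeps each class finite and lets
    [reduced_inj] recover the one exponent that may exceed 1. *)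
Definition cls a := (mdeg a, theta a).

(** [theta] is read off the parities of [vdeg], and [vdeg] is additive. *)
Lemma cls_add2r m a b : cls a = cls b -> cls (a + m)%MM = cls (b + m)%MM.
Proof.
case=> dab thab; rewrite /cls !mdegD dab !thetaE; congr pair.
move: thab; rewrite !thetaE => /setP thab.
apply/setP=> v; rewrite !inE !vdegD !oddD.
by have:= thab v; rewrite !inE => ->.
Qed.

Lemma modn2_odd (k l : nat) : k = l %[mod 2] <-> odd k = odd l.
Proof. by rewrite !modn2; split=> [|->] //; case: (odd k); case: (odd l). Qed.

Definition mset J : mon G := [multinom (enum_val i \in J : nat) | i < #|{: edge G}|].

Lemma expo_mset J h : expo (mset J) h = (h \in J).
Proof. by rewrite /expo mnmE enum_rankK. Qed.

Lemma Jset_mset J : Jset (mset J) = J.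
Proof. by apply/setP=> h; rewrite inE expo_mset oddb. Qed.

Lemma mdeg_mset J : mdeg (mset J) = #|J|.
Proof.
rewrite mdeg_expo -sum1_card [RHS]big_mkcond /=.
by apply: eq_bigr => h _; rewrite expo_mset; case: (h \in J).
Qed.

Lemma expo_le a b : (forall h : edge G, (expo a h <= expo b h)%N) -> (a <= b)%MM.
Proof.
by move=> leab; apply/mnm_lepP => i; have:= leab (enum_val i); rewrite /expo enum_valK.
Qed.

Lemma mset_le J a : J \subset Jset a -> (mset J <= a)%MM.
Proof.
move=> /subsetP sJ; apply: expo_le => h; rewrite expo_mset.
by case: (boolP (h \in J)) => // /sJ; rewrite inE; case: (expo a h).
Qed.

End Parity.

(** * Leading monomials of the Gröbner basis and the monomials that none of them divides *)

Section Binomials.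
Variables (K : fieldType) (G : sgraph) (e : 'I_#|{: edge G}| -> edge G).
Implicit Types (A B C J : {set edge G}) (a b c d m : mon G) (g p : epoly K G).

Lemma msupp_binomial a b m :
  m \in msupp ('X_[a] - 'X_[b] : epoly K G) -> m = a \/ m = b.
Proof.
rewrite mcoeff_msupp mcoeffB !mcoeffX.
have [->|_] := eqVneq a m; first by left.
have [->|_] := eqVneq b m; first by right.
by rewrite subrr eqxx.
Qed.

Lemma is_lead_binomial a b :
  a != b -> grevlex_le e b a -> is_lead e ('X_[a] - 'X_[b] : epoly K G) a.
Proof.
move=> neab leba; split.
  rewrite mcoeff_msupp mcoeffB !mcoeffX eqxx [b == a]eq_sym (negPf neab).
  by rewrite subr0 oner_eq0.
by move=> m /msupp_binomial[->|->] //; rewrite /grevlex_le eqxx.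
Qed.

(** For a difference of squares both [theta] are empty. For an Eulerian binomial the two edge sets
    are disjoint, so their degrees at v have an even sum, hence equal parities. *)
Lemma Gset_binomial g :
  Gset g -> exists a b, g = 'X_[a] - 'X_[b] /\ cls a = cls b.
Proof.
case=> [[h [l [_ ->]]]|[a [b [-> [_ rel _ _] dab [ev _]]]]].
  exists (U_(enum_rank h) *+ 2)%MM, (U_(enum_rank l) *+ 2)%MM.
  rewrite !mpolyXn; split=> //.
  rewrite /cls !mdegMn !mdeg1 !thetaE; congr pair.
  by apply/setP=> v; rewrite !inE !mulmS !mulm0n !addm0 !vdegD !addnn !odd_double.
exists a, b; split=> //; rewrite /cls dab; congr pair.
rewrite /theta !odd_verticesE; apply/setP=> v; rewrite !inE.
have Jab : [disjoint Jset a & Jset b].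
  rewrite -setI_eq0; apply/eqP/setP=> h; rewrite !inE.
  by case: (rel h) => ->; rewrite // andbF.
(* [even_eulerian] constrains only the induced vertices; at any other vertex the degree cannot be
   odd by [odd_verticesE]. *)
have: ~~ odd (degree (Jset a :|: Jset b) v).
  have [/ev//|] := boolP (v \in induced_vertices (Jset a :|: Jset b)).
  apply: contra => odd_v.
  have /setP/(_ v) := odd_verticesE (Jset a :|: Jset b).
  by rewrite !inE odd_v => /andP[].
rewrite (degree_split _ (Jset a)) setUK setDUl setDv set0U.
have /setDidPl-> : [disjoint Jset b & Jset a] by rewrite disjoint_sym.
by rewrite oddD; do 2!case: (odd _).
Qed.

Hypothesis he : bijective e.

Definition reduced m : Prop :=
  forall g l, @Gset K G g -> is_lead e g l -> ~~ (l <= m)%MM.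

(** For h < l the variable of [e h] is the larger one, so its square leads the difference of the two
    squares. Only the last variable can thus have an exponent above 1. *)
Lemma reduced_expo_le1 m (l h : 'I_#|{: edge G}|) :
  reduced m -> (h < l)%N -> (expo m (e h) <= 1)%N.
Proof.
move=> red_m lthl; rewrite leqNgt; apply/negP=> gt1.
have neq_e : e h != e l.
  by rewrite (inj_eq (bij_inj he)); apply: contraTneq lthl => ->; rewrite ltnn.
have TE x : tvar K x ^+ 2 = 'X_[U_(enum_rank x) *+ 2] :> epoly K G.
  by rewrite mpolyXn.
have expoU x y : expo (U_(enum_rank x) *+ 2)%MM y = ((x == y) * 2)%N :> nat.
  by rewrite /expo mulmnE mnm1E (inj_eq enum_rank_inj) mulnC.
have ne : (U_(enum_rank (e h)) *+ 2 != U_(enum_rank (e l)) *+ 2 :> mon G)%MM.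
  apply/eqP=> /(congr1 (fun m => expo m (e h))).
  by rewrite !expoU eqxx eq_sym (negPf neq_e).
have Gg : @Gset K G (tvar K (e h) ^+ 2 - tvar K (e l) ^+ 2).
  by left; exists (e h), (e l).
have ld : is_lead e (tvar K (e h) ^+ 2 - tvar K (e l) ^+ 2)
                  (U_(enum_rank (e h)) *+ 2)%MM.
  rewrite !TE; apply: is_lead_binomial => //.
  apply/orP; right; apply/orP; right; rewrite !mdegMn !mdeg1 eqxx /=.
  apply/existsP; exists l; rewrite !expoU eqxx (negPf neq_e) /=.
  apply/forallP=> j; apply/implyP=> ltlj; rewrite !expoU !(inj_eq (bij_inj he)).
  by rewrite -!val_eqE /= (ltn_eqF ltlj) (ltn_eqF (ltn_trans lthl ltlj)).
have /negP[] := red_m _ _ Gg ld.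
by apply: expo_le => y; rewrite expoU; case: eqP => [<-|].
Qed.

(** The last edge of [A :|: B] lies in A, so grevlex makes t^A the smaller monomial; t^B then leads
    an Eulerian binomial and cannot divide t^m. *)
Lemma reduced_eulerian m A B (s : 'I_#|{: edge G}|) :
    reduced m -> [disjoint A & B] -> #|A| = #|B| -> even_eulerian (A :|: B) ->
    e s \in A -> (forall j : 'I_#|{: edge G}|, (s < j)%N -> e j \notin A :|: B) ->
  ~~ (B \subset Jset m).
Proof.
move=> red_m dAB cAB evAB sA smax; apply/negP=> /mset_le; apply/negP.
have sNB : (e s \in B) = false by apply: disjointFr sA.
have ne : mset B != mset A.
  by apply: contraFneq sNB => /(congr1 (@Jset G)); rewrite !Jset_mset => ->.
apply: (red_m ('X_[mset B] - 'X_[mset A])).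
  right; exists (mset B), (mset A); split=> //.
  - split; first exact/eqP.
    + move=> h; rewrite !expo_mset; case: (boolP (h \in A)) => hA.
        by left; rewrite (disjointFr dAB hA).
      by right.
    + by move=> h; rewrite expo_mset leq_b1.
    + by move=> h; rewrite expo_mset leq_b1.
  - by rewrite !mdeg_mset.
  - by rewrite !Jset_mset setUC.
apply: is_lead_binomial => //; apply/orP; right; apply/orP; right.
rewrite !mdeg_mset cAB eqxx /=; apply/existsP; exists s.
rewrite !expo_mset sNB sA /=; apply/forallP=> j; apply/implyP=> /smax.
by rewrite inE negb_or !expo_mset => /andP[/negPf-> /negPf->].
Qed.

Lemma last_edge A : A != set0 ->
  exists2 s, e s \in A & forall j : 'I_#|{: edge G}|, (s < j)%N -> e j \notin A.
Proof.
case/set0Pn=> h hA; have [f _ eK] := he.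
have fhA : e (f h) \in A by rewrite eK.
have [s sA smax] := @arg_maxnP _ (f h) (fun i => e i \in A) val fhA.
exists s => // j ltsj.
by apply: contraL ltsj => /smax; rewrite -leqNgt.
Qed.

(* If |J| < |J(m)|, then m contains more than half of the edges of the even
   Eulerian symmetric difference F, so half of F can be chosen inside m while
   avoiding the grevlex-smallest edge of F; it leads an Eulerian binomial. *)
Lemma reduced_min m J :
    reduced m -> odd_vertices J = theta m -> odd #|J| = odd #|Jset m| ->
  (#|Jset m| <= #|J|)%N.
Proof.
move=> red_m thJ cJ; rewrite leqNgt; apply/negP=> ltJ.
set D := Jset m in thJ cJ ltJ.
have ev := even_eulerian_symdiff thJ cJ.
set F := _ :|: _ in ev.
have cJ' := cardsID D J; have cD' := cardsID J D; rewrite setIC in cD'.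
have cF : #|F| = (#|J :\: D| + #|D :\: J|)%N.
  rewrite cardsU (_ : _ :&: _ = set0) ?cards0 ?subn0 //; apply/setP=> h.
  by rewrite !in_setI !in_setD in_set0; case: (h \in J); rewrite ?andbF.
have [k cDk] := odd_eq_gap (esym cJ) ltJ.
have {}cDk : #|D :\: J| = (#|J :\: D| + k.+1 * 2)%N.
  by apply: (@addnI #|J :&: D|); rewrite addnA cD' cJ'.
have [|s sF smax] := @last_edge F; first by rewrite -card_gt0 cF; lia.
(* The left side is half of |F|. Removing at most one edge from [D :\: J] leaves at least |J \ D| +
   2k + 1 edges, which suffices. *)
have leB : (#|J :\: D| + k.+1 <= #|(D :\: J) :\ e s|)%N.
  have:= cardsD1 (e s) (D :\: J); move: cDk;
    move: #|D :\: J| #|J :\: D| #|_ :\ _| => x y z; case: (_ \in _); clear; lia.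
have [B sB cB] := exists_subset_card leB.
have sBF : B \subset F.
  by apply: subset_trans sB (subset_trans (subsetDl _ _) (subsetUr _ _)).
have UF : (F :\: B) :|: B = F by rewrite setUC -[RHS](setID F B) (setIidPr sBF).
have: ~~ (B \subset D).
  apply: (@reduced_eulerian m (F :\: B) B s) => //; last by rewrite UF.
  - by rewrite -setI_eq0 setDE -setIA [~: B :&: B]setIC setICr setI0.
  - have:= cardsID B F; rewrite (setIidPr sBF) cB cF; lia.
  - by rewrite UF.
  rewrite inE sF andbT; apply/negP=> /(subsetP sB).
  by rewrite !inE eqxx.
by rewrite (subset_trans sB) // (subset_trans (subsetDl _ _)) ?subsetDl.
Qed.

(** By minimality both odd parts have the same size, so their two differences form an Eulerian
    binomial unless they are empty. Whichever difference holds the last edge, the other one leads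
    and divides a reduced monomial. *)
Lemma reduced_Jset_eq a b :
    reduced a -> reduced b -> theta a = theta b ->
    odd #|Jset a| = odd #|Jset b| ->
  Jset a = Jset b.
Proof.
move=> ra rb thab cab.
have eqc : #|Jset a| = #|Jset b|.
  by apply/eqP; rewrite eqn_leq !reduced_min.
have ev := even_eulerian_symdiff thab cab.
apply/eqP; apply: contraT => neab.
set A := Jset a :\: Jset b in ev *; set B := Jset b :\: Jset a in ev *.
have cAB : #|A| = #|B|.
  have:= cardsID (Jset b) (Jset a); have:= cardsID (Jset a) (Jset b).
  rewrite (setIC (Jset b)) /A /B; lia.
have dAB : [disjoint A & B].
  rewrite -setI_eq0; apply/eqP/setP=> h; rewrite !inE.
  by case: (odd (expo a h)); case: (odd (expo b h)).
have [|s] := @last_edge (A :|: B).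
  apply: contraNneq neab => /setP AB0; apply/eqP/setP=> h.
  have:= AB0 h; rewrite !in_setU !in_setD in_set0.
  by case: (h \in Jset a); case: (h \in Jset b).
rewrite in_setU => /orP[sA|sB] smax.
  by have:= reduced_eulerian rb dAB cAB ev sA smax; rewrite subsetDl.
rewrite setUC in ev smax; rewrite disjoint_sym in dAB.
by have:= reduced_eulerian ra dAB (esym cAB) ev sB smax; rewrite subsetDl.
Qed.

(** The common odd part determines every exponent that is at most 1, that is, all but the one of the
    last variable; equality of degrees fixes that one. *)
Lemma reduced_inj a b : reduced a -> reduced b -> cls a = cls b -> a = b.
Proof.
move=> ra rb [dab thab].
have Jab : Jset a = Jset b.
  by apply: reduced_Jset_eq => //; rewrite !odd_card_Jset dab.
suff expo_ab h : expo a h = expo b h.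
  by apply/mnmP=> i; have:= expo_ab (enum_val i); rewrite /expo enum_valK.
have [|l _ lmax] := @last_edge [set: edge G].
  by apply/set0Pn; exists h.
have [f fK eK] := he.
have sq x : x != e l -> expo a x = expo b x.
  move=> nexl; have ltfl : (f x < l)%N.
    rewrite ltnNge leq_eqVlt negb_or; apply/andP; split.
      by rewrite val_eqE; apply: contraNneq nexl => ->; rewrite eK.
    by apply/negP=> /lmax; rewrite inE.
  have:= reduced_expo_le1 ra ltfl; have:= reduced_expo_le1 rb ltfl; rewrite eK.
  move/setP/(_ x): Jab; rewrite !inE.
  by case: (expo a x) => [|[]] //; case: (expo b x) => [|[]].
have [->|/sq//] := eqVneq h (e l).
move: dab; rewrite !mdeg_expo (bigD1 (e l)) //= [in RHS](bigD1 (e l)) //=.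
by rewrite (eq_bigr _ sq) => /addIn.
Qed.

End Binomials.

(** * Sums of coefficients over a class *)

Section ClassSum.
Variables (K : fieldType) (G : sgraph).
Implicit Types (a b c d m : mon G) (p q : epoly K G).

(* The monomials of class [k] all have degree [k.1], so the range of summation
   misses none of them. *)
Definition class_sum (k : nat * {set vertex G}) p : K :=
  \sum_(m : 'X_{1..#|{: edge G}| < k.1.+1} | cls m == k) p@_m.

Lemma class_sum0 k : class_sum k 0 = 0.
Proof. by rewrite /class_sum big1 // => m _; rewrite mcoeff0. Qed.

Lemma class_sumD k p q : class_sum k (p + q) = class_sum k p + class_sum k q.
Proof. by rewrite -big_split; apply: eq_bigr => m _; rewrite mcoeffD. Qed.

Lemma class_sumZ k (x : K) p : class_sum k (x *: p) = x * class_sum k p.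
Proof. by rewrite /class_sum big_distrr; apply: eq_bigr => m _; rewrite mcoeffZ. Qed.

Lemma class_sum_single k a p : cls a = k ->
    (forall m, cls m = k -> m != a -> p@_m = 0) ->
  class_sum k p = p@_a.
Proof.
move=> ka p0; have lta : (mdeg a < k.1.+1)%N by rewrite -ka.
rewrite /class_sum (bigD1 (BMultinom lta)) /= ?ka ?eqxx // big1 ?addr0 //.
by move=> m /andP[/eqP km]; rewrite -val_eqE /= => nema; apply: p0.
Qed.

Lemma class_sum_eq0 k p : (forall m, cls m = k -> p@_m = 0) -> class_sum k p = 0.
Proof. by move=> p0; rewrite /class_sum big1 // => m /eqP/p0. Qed.

Lemma class_sumX k a : class_sum k 'X_[a] = (cls a == k)%:R.
Proof.
have [ka|neka] := eqVneq (cls a) k.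
  rewrite (class_sum_single ka) ?mcoeffX ?eqxx // => m _.
  by rewrite mcoeffX eq_sym => /negPf->.
apply: class_sum_eq0 => m km; rewrite mcoeffX.
by case: eqP => // am; rewrite am km eqxx in neka.
Qed.

(** By linearity q may be taken to be a monomial t^m; then t^(m+a) and t^(m+b) share a class and
    their coefficients 1 and -1 cancel. *)
Lemma class_sum_mul_binomial k q a b :
  cls a = cls b -> class_sum k (q * ('X_[a] - 'X_[b])) = 0.
Proof.
move=> cab; rewrite [q]mpolyE mulr_suml.
apply: (big_ind (fun p => class_sum k p = 0)); first exact: class_sum0.
  by move=> p1 p2 p10 p20; rewrite class_sumD p10 p20 addr0.
move=> m _; rewrite -scalerAl class_sumZ mulrBr -!mpolyXD -scaleN1r.
rewrite class_sumD class_sumZ !class_sumX ![(m + _)%MM]addmC.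
by rewrite (cls_add2r m cab) mulN1r subrr mulr0.
Qed.

End ClassSum.

(** * Invariants of a division step, and the remainder of a monomial *)

Theorem theorem4p3 (K : fieldType) (G : sgraph)
    (hG : no_isolated_vertex G) (hE : (1 < #|edges G|)%N)
    (e : 'I_#|{: edge G}| -> edge G) (he : bijective e) :
  (forall (d c : mon G) (g : epoly K G),
     Gset g -> division_remainder e g c d ->
     theta d = theta c /\ (#|Jset d| = #|Jset c| %[mod 2])%N)
  /\
  (forall (c : mon G) (gs : seq (epoly K G)) (q : epoly K G -> epoly K G)
          (r : epoly K G),
     standard_expression e (@Gset K G) 'X_[c] gs q r ->
     exists d : mon G,
       r = 'X_[d] /\
       is_min (fun k => exists J : {set edge G},
                 [/\ is_join (theta c) J, (#|J| = #|Jset c| %[mod 2])%N & #|J| = k])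
              #|Jset d|).
Proof.
split.
  move=> d c g Gg [m [m' [[mg _] m'g _ lemc ->]]].
  have [a [b [gE cab]]] := Gset_binomial Gg.
  (* Both monomials lie in {a, b}, so it does not matter which of the two leads. *)
  have cmm' : cls m' = cls m.
    by move: mg m'g; rewrite gE => /msupp_binomial[->|->] /msupp_binomial[->|->].
  have [dE thE] : cls (c - m + m')%MM = cls c.
    by rewrite addmC (cls_add2r _ cmm') addmC submK.
  by rewrite thE; split=> //; apply/modn2_odd; rewrite !odd_card_Jset dE.
move=> c gs q r [[_ gsG] cE rred _].
have red m : m \in msupp r -> reduced K e m by move=> mr g l; apply: rred.
have sum_r k : class_sum k r = (cls c == k)%:R.
  rewrite -(class_sumX K) cE class_sumD big_seq.
  set s := \sum_(_ <- _ | _) _; suff -> : class_sum k s = 0 by rewrite add0r.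
  apply: (big_ind (fun p => class_sum k p = 0)); first exact: class_sum0.
    by move=> p1 p2 p10 p20; rewrite class_sumD p10 p20 addr0.
  move=> g /gsG/Gset_binomial[a [b [-> cab]]]; exact: class_sum_mul_binomial.
(* All monomials of r are reduced, so m is the only one in its class and its coefficient is the
   whole class sum. *)
have coef_r m : m \in msupp r -> r@_m = (cls c == cls m)%:R.
  move=> mr; rewrite -sum_r (class_sum_single (erefl (cls m))) // => m' cm'.
  apply: contraNeq; rewrite -mcoeff_msupp => m'r.
  by apply/eqP/(reduced_inj he) => //; apply: red.
(* The sum of r over the class of c is 1, so some monomial of r lies in that class. *)
have [d dr cd] : exists2 d, d \in msupp r & cls c = cls d.
  have [/hasP[d dr /eqP cd]|/hasPn Nd] := boolP (has (fun d => cls c == cls d) (msupp r)).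
    by exists d.
  have /eqP := sum_r (cls c); rewrite eqxx class_sum_eq0 1?eq_sym ?oner_eq0 // => m cm.
  by apply/eqP; apply: contraT; rewrite -mcoeff_msupp => /Nd; rewrite cm eqxx.
exists d; split.
  apply/mpolyP=> m; rewrite mcoeffX.
  have [mr|Nmr] := boolP (m \in msupp r).
    rewrite coef_r //; congr (nat_of_bool _)%:R; rewrite cd.
    (* Between monomials of r, equality of classes is equality, so the coefficient is 1 at d and 0
       elsewhere. *)
    by apply/eqP/eqP=> [|->] //; apply: (reduced_inj he); apply: red.
  rewrite memN_msupp_eq0 //; case: eqP => // dm.
  by rewrite -dm dr in Nmr.
have [mdegcd thcd] := cd.
have par : odd #|Jset c| = odd #|Jset d| by rewrite !odd_card_Jset mdegcd.
split.
  (* The minimum is attained by the odd part of d itself, since d has the class of c. *)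
  by exists (Jset d); split=> //; apply/modn2_odd.
move=> k [J [thJ /modn2_odd cJ <-]].
by apply: (reduced_min he (red d dr)); rewrite ?cJ // thJ.
Qed.
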